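(* For every integer $d\ge 3$ there exist constants $\alpha_d,\beta_d$, depending only on $d$, such that for every $n$ and every $d$-regular graph $G$ on $n$ vertices, $s^{*}_{d-2}(G)\le \alpha_d+\beta_d\log n$; that is, $s^{*}_{d-2}(n,d)\le \alpha_d+\beta_d\log n$.
   Context: For a graph $G$ and a positive integer $b$, the $(1:b)$ Maker--Breaker component game on $G$ is played as follows: two players, Maker and Breaker, alternately claim previously unclaimed (free) edges of $G$; Maker moves first, and on each move Maker claims one free edge and Breaker claims $b$ free edges (a player who cannot complete his quota claims all remaining free edges). The game ends when all edges are claimed. $s^{*}_{b}(G)$ denotes the largest integer $s$ such that Maker has a strategy guaranteeing that, at the end of the $(1:b)$ game on $G$, the graph formed by Maker's edges has a connected component with at least $s$ vertices. For $d\ge 3$, $s^{*}_{b}(n,d)=\max\{s^{*}_{b}(G): G \text{ is a } d\text{-regular graph on } n \text{ vertices}\}$. *)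

(* Defs.v *)
From HB Require Import structures.
From mathcomp Require Import all_boot.
From mathcomp Require Import boolp.

Set Implicit Arguments.
Unset Strict Implicit.
Unset Printing Implicit Defensive.

(* An edge is the two-element set of its endpoints, so that both the edges and
   the simple graphs on a finType form finTypes. *)
Record sgraph (T : finType) := SGraph {
  edges :> {set {set T}};
  _ : [forall e in edges, #|e| == 2] }.

HB.instance Definition _ (T : finType) := [isSub for @edges T].
HB.instance Definition _ (T : finType) := [Finite of sgraph T by <:].

Section Graphs.
Variable T : finType.

Definition degree (G : sgraph T) (x : T) : nat := #|[set e in edges G | x \in e]|.

Definition regular (d : nat) (G : sgraph T) : bool :=
  [forall x, degree G x == d].

Definition adj (M : {set {set T}}) : rel T := [rel x y | [set x; y] \in M].

(* The graph has vertex set T: an isolated vertex is a component of size 1. *)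
Definition has_component (M : {set {set T}}) (s : nat) : bool :=
  [exists x, s <= #|connect (adj M) x|].

End Graphs.

Section Game.
Variables (T : finType) (b : nat) (G : sgraph T).

(* A round is the edge claimed by Maker and the set of edges that Breaker
   claims in reply; a history lists the completed rounds, oldest first. *)
Definition history := seq ({set T} * {set {set T}}).

Definition maker_edges (h : history) : {set {set T}} :=
  [set e in [seq r.1 | r <- h]].

Definition breaker_edges (h : history) : {set {set T}} :=
  \bigcup_(r <- h) r.2.

Definition free (h : history) : {set {set T}} :=
  edges G :\: (maker_edges h :|: breaker_edges h).

(* When fewer than b edges are free, Breaker claims all of them. *)
Definition breaker_reply (F D : {set {set T}}) : bool :=
  (D \subset F) && (#|D| == minn b #|F|).

Definition strategy := history -> {set T}.

(* The histories that can arise when Maker follows sigma. *)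
Inductive play (sigma : strategy) : history -> Prop :=
| play_start : play sigma [::]
| play_round h D : play sigma h -> sigma h \in free h ->
    breaker_reply (free h :\ sigma h) D ->
    play sigma (rcons h (sigma h, D)).

Definition legal (sigma : strategy) : Prop :=
  forall h, play sigma h -> free h != set0 -> sigma h \in free h.

Definition maker_guarantees (s : nat) : Prop :=
  exists2 sigma, legal sigma &
    forall h, play sigma h -> free h = set0 -> has_component (maker_edges h) s.

(* No component has more than #|T| vertices, so the range of s is harmless:
   see s_star_guaranteed and s_star_max. *)
Definition s_star : nat :=
  \max_(s < #|T|.+1 | `[< maker_guarantees s >]) s.

Lemma maker_guarantees0 : 0 < #|T| -> maker_guarantees 0.
Proof.
case/card_gt0P => x _.
exists (fun h => odflt set0 [pick e in free h]) => [h _ /set0Pn[e eF]|h _ _].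
  by case: pickP => [//|/(_ e)]; rewrite eF.
by apply/existsP; exists x.
Qed.

Lemma s_star_guaranteed : 0 < #|T| -> maker_guarantees s_star.
Proof.
move=> T0; rewrite /s_star; apply: (big_ind maker_guarantees).
- exact: maker_guarantees0.
- by move=> m n Hm Hn; case: (leqP m n).
- by move=> s /asboolP.
Qed.

Lemma play_end (sigma : strategy) :
  legal sigma -> exists2 h, play sigma h & free h = set0.
Proof.
move=> Hl.
suff H n h : play sigma h -> #|free h| <= n ->
    exists2 h, play sigma h & free h = set0.
  exact: (H #|free [::]| [::] (play_start sigma)).
elim: n h => [|n IH] h ph.
  by rewrite leqn0 cards_eq0 => /eqP F0; exists h.
have [F0 _|F0 le] := eqVneq (free h) set0; first by exists h.
have sF := Hl h ph F0.
pose s := take b (enum (free h :\ sigma h)).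
have ssub : {subset s <= enum (free h :\ sigma h)} by move=> e /mem_take.
have rep : breaker_reply (free h :\ sigma h) [set e in s].
  apply/andP; split.
    by apply/subsetP => e; rewrite inE => /ssub; rewrite mem_enum.
  rewrite cardsE (card_uniqP _) ?take_uniq ?enum_uniq //.
  by rewrite size_take_min -cardE.
apply: (IH _ (play_round ph sF rep)).
rewrite -ltnS; apply: leq_trans le; apply: proper_card; apply/properP; split.
  apply/subsetP => e; rewrite !inE /breaker_edges -cats1 big_cat big_seq1 /=.
  rewrite map_cat mem_cat inE [_ \in _ :|: _]inE !negb_or -!andbA.
  by case/and4P => -> _ -> /andP[_ ->].
by exists (sigma h) => //; rewrite !inE map_rcons mem_rcons inE eqxx.
Qed.

Lemma s_star_max s : maker_guarantees s -> s <= s_star.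
Proof.
move=> Hs; have [sigma Hl Hg] := Hs.
have [h ph F0] := play_end Hl.
have /existsP[x sx] := Hg h ph F0.
have ltsT : s < #|T|.+1 by rewrite ltnS (leq_trans sx) ?max_card.
exact: (@leq_bigmax_cond _ _ (fun s : 'I__ => s : nat) (Ordinal ltsT))
  (asboolT Hs).
Qed.

End Game.

(* The value is 0 when there is no d-regular graph on n vertices. *)
Definition s_star_nd (b n d : nat) : nat :=
  \max_(G : sgraph 'I_n | regular d G) s_star b G.

(* Main.v *)
Require Import Defs.
From mathcomp Require Import all_boot all_order all_algebra zify.
From mathcomp Require Import boolp reals exp.
Import Order.TTheory GRing.Theory Num.Theory.

Set Implicit Arguments.
Unset Strict Implicit.
Unset Printing Implicit Defensive.

(** Orient [G] so that every vertex has an out-arc and every simple directed path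
    has [O(log n)] vertices: take a maximal family of pairwise non-adjacent cycles
    of logarithmic length, oriented cyclically, and orient all other edges towards
    it, first by the distance to it and then by a proper colouring.  Every vertex
    is near the family because [2 ^ k > n] non-backtracking walks of length [k]
    cannot have distinct ends.
    Breaker keeps every component of Maker either open, with all its free in-arcs
    at one root from which few directed paths cover it, or closed, without free
    in-arcs.  When Maker claims an arc into a root, Breaker takes the other arcs
    into that root and spends his remaining edges either on the in-arcs of the
    component that Maker comes from or, when there are none, on the out-arcs of
    the component that was reached, where only a longest path is left alive. *)

(** * Blocks of vertices and Breaker's reply to a single edge of Maker *)

Section Blocks.
Variables (T A : finType) (src tgt : A -> T) (e : rel T) (d L : nat).
Hypothesis dipath_le : forall p, sorted e p -> uniq p -> size p <= L.
Implicit Types (F K : {set A}) (C D : {set T}) (t : A * seq T)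
  (ts : seq (A * seq T)).

Definition ins F C := [set a in F | tgt a \in C].
Definition outs F C := [set a in F | src a \in C].

(* A label outside F marks a trail whose out-arc has been claimed. *)
Definition trail F C t :=
  [&& t.2 != [::], sorted e t.2, uniq t.2, all [in C] t.2 &
      (t.1 \in F) ==> (last (src t.1) t.2 == src t.1)].

Definition tracks F C ts :=
  all (trail F C) ts && (outs F C \subset [seq t.1 | t <- ts]).

(* Entering the root costs Breaker at most [d - 2 - w] edges, so [w] are spare. *)
Definition open_block F C := exists r w ts,
  [/\ forall a, a \in ins F C -> tgt a = r, #|ins F C| + w < d,
      tracks F C ts, size ts <= w.+1 &
      all (fun t => head r t.2 == r) ts && (C \subset flatten [seq t.2 | t <- ts])].

(** The first summand bounds the vertices of a block that has just closed, covered by at most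
    [2 * d] trails of at most [L] vertices; the second bounds the total weight of these trails, at
    most [2 * d * L] each. *)
Definition block_bound := 2 * d * L + 4 * d * d * L.

(** As trails have at most [L] vertices, the factor 2 leaves each a weight of at least [d * L],
    enough to pay for a whole open block none of whose trails survives. *)
Definition weight t := d * (2 * L - size t.2).

(* Prolonging a trail lowers its weight by enough to pay for the block attached. *)
Definition closed_block F C := ins F C = set0 /\ exists2 ts,
  tracks F C ts & #|C| + \sum_(t <- ts) weight t <= block_bound.

Definition good_block F C := open_block F C \/ closed_block F C.

Lemma insS F F' C : F' \subset F -> ins F' C \subset ins F C.
Proof.
by move=> sF; apply/subsetP => a; rewrite !inE => /andP[/(subsetP sF)-> ->].
Qed.

Lemma outsS F F' C : F' \subset F -> outs F' C \subset outs F C.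
Proof.
by move=> sF; apply/subsetP => a; rewrite !inE => /andP[/(subsetP sF)-> ->].
Qed.

Lemma trailS F F' C C' t : F' \subset F -> C \subset C' ->
  trail F C t -> trail F' C' t.
Proof.
move=> sF sC /and5P[t0 ts tu /allP tC /implyP tl]; apply/and5P; split=> //.
  by apply/allP => x /tC; apply: (subsetP sC).
by apply/implyP => /(subsetP sF)/tl.
Qed.

Lemma trail_size_le F C t : trail F C t -> size t.2 <= L.
Proof. by case/and5P => _ ts tu _ _; apply: dipath_le. Qed.

Lemma tracksS F F' C ts ts' : F' \subset F -> tracks F C ts ->
  {subset ts' <= ts} -> outs F' C \subset [seq t.1 | t <- ts'] ->
  tracks F' C ts'.
Proof.
move=> sF /andP[/allP tr _] sts o'; rewrite /tracks o' andbT.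
by apply/allP => t /sts/tr; apply: trailS.
Qed.

Lemma tracks_mono F F' C ts : F' \subset F -> tracks F C ts -> tracks F' C ts.
Proof.
move=> sF tr; apply: (tracksS sF tr) => //.
by case/andP: tr => _; apply/subset_trans/outsS.
Qed.

Lemma good_blockS F F' C : F' \subset F -> good_block F C -> good_block F' C.
Proof.
move=> sF [[r [w [ts [insr insw tr sz cov]]]]|[ins0 [ts tr wt]]].
  left; exists r, w, ts; split=> //.
  - by move=> a /(subsetP (insS C sF)); apply: insr.
  - by apply: leq_ltn_trans insw; rewrite leq_add2r subset_leq_card ?insS.
  - exact: tracks_mono sF tr.
right; split; first by apply/eqP; rewrite -subset0 -ins0 insS.
by exists ts => //; apply: tracks_mono tr.
Qed.

Lemma card_cover_le C ts m : C \subset flatten [seq t.2 | t <- ts] ->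
  {in ts, forall t, size t.2 <= m} -> #|C| <= size ts * m.
Proof.
move=> cov szm; apply: leq_trans (_ : size (flatten [seq t.2 | t <- ts]) <= _).
  by apply: leq_trans (subset_leq_card cov) (card_size _).
elim: ts szm {cov} => //= t ts IH szm; rewrite size_cat mulSn leq_add ?szm ?inE ?eqxx //.
by apply: IH => s sts; apply: szm; rewrite inE sts orbT.
Qed.

Lemma closed_blockI F C ts n : ins F C = set0 -> tracks F C ts ->
  C \subset flatten [seq t.2 | t <- ts] -> size ts <= n -> n <= 2 * d ->
  closed_block F C.
Proof.
move=> ins0 tr cov szn n2; split=> //; exists ts => //.
have trL : {in ts, forall t, size t.2 <= L}.
  by move=> t; case/andP: tr => /allP tr _ /tr/trail_size_le.
have cC := card_cover_le cov trL.
have : \sum_(t <- ts) weight t <= size ts * (d * (2 * L)).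
  rewrite -sum1_size big_distrl /=; apply: leq_sum => t _.
  by rewrite mul1n leq_mul2l leq_subr orbT.
move: (\sum_(t <- ts) _) cC szn n2 => W; rewrite /block_bound; clear; nia.
Qed.

Lemma good_block_card F C : good_block F C -> #|C| <= block_bound.
Proof.
case=> [[r [w [ts [_ insw tr sz /andP[_ cov]]]]]|[_ [ts _]]]; last first.
  by apply: leq_trans; apply: leq_addr.
have trL : {in ts, forall t, size t.2 <= L}.
  by move=> t; case/andP: tr => /allP tr _ /tr/trail_size_le.
have cC := card_cover_le cov trL.
rewrite /block_bound; nia.
Qed.

(* The trails of D prolong the trail of C that ends at the source of the arc [t0.1]. *)
Definition join ts (t0 : A * seq T) ts' :=
  rem t0 ts ++ [seq (t.1, t0.2 ++ t.2) | t <- ts'].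

Lemma mem_join ts t0 ts' t : t \in join ts t0 ts' ->
  t \in ts \/ exists2 t', t' \in ts' & t = (t'.1, t0.2 ++ t'.2).
Proof.
rewrite mem_cat => /orP[/mem_rem|/mapP[t' t'ts ->]]; first by left.
by right; exists t'.
Qed.

Lemma size_join ts t0 ts' : t0 \in ts ->
  size (join ts t0 ts') = (size ts).-1 + size ts'.
Proof. by move=> t0ts; rewrite size_cat size_map size_rem. Qed.

(** While [t0.1] is free, [t0] ends at its source, and the arc leads to [v], where all trails of
    [ts'] start; disjointness of the blocks keeps the concatenations simple. Dropping [t0] loses no
    out-arc, since its label is not in [F']. *)
Lemma tracks_join F F' C D v ts ts' t0 : F' \subset F :\ t0.1 ->
  [disjoint C & D] -> t0 \in ts -> t0.1 \in F -> tgt t0.1 = v -> e (src t0.1) v ->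
  tracks F C ts -> tracks F' D ts' -> all (fun t => head v t.2 == v) ts' ->
  tracks F' (C :|: D) (join ts t0 ts').
Proof.
rewrite subsetD1 => /andP[sF t0F'] dis t0ts t0F t0v euv /andP[/allP tr oC].
case/andP=> /allP tr' oD /allP hd; apply/andP; split.
  apply/allP => t /mem_join[/tr|[t' t'ts' ->]].
    by apply: trailS => //; apply: subsetUl.
  have /and5P[t00 t0s t0u /allP t0C t0l] := tr _ t0ts.
  have /and5P[t'0 t's t'u /allP t'D t'l] := tr' _ t'ts'.
  have {}hd := hd _ t'ts'.
  rewrite /trail /=; apply/and5P; split.
  - by case: (t0.2) t00.
  - case: (t0.2) (t00) t0s t0l => //= x p _ t0s.
    rewrite t0F /= => /eqP t0l; case: (t'.2) t'0 hd t's => //= y q _ /eqP-> q_s.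
    by rewrite cat_path t0s /= t0l euv.
  - rewrite cat_uniq t0u t'u andbT; apply/hasPn => x /t'D xD.
    by apply/negP => /t0C xC; move/pred0P: dis => /(_ x) /=; rewrite xC xD.
  - rewrite all_cat; apply/andP; split; apply/allP => x.
      by move/t0C => /= xC; rewrite inE xC.
    by move/t'D => /= xD; rewrite inE xD orbT.
  - apply/implyP => aF; move: t'l; rewrite aF /= last_cat.
    by case: (t'.2) t'0.
apply/subsetP => a; rewrite !inE => /andP[aF' aCD].
rewrite map_cat mem_cat; case/orP: aCD => [aC|aD].
  have /(subsetP oC)/mapP[t tts at1] : a \in outs F C.
    by rewrite inE aC (subsetP sF).
  apply/orP; left; apply/mapP; exists t => //.
  move: tts; rewrite (perm_mem (perm_to_rem t0ts)) inE => /orP[/eqP tE|//].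
  by move: t0F'; rewrite -tE -at1 aF'.
have /(subsetP oD)/mapP[t tts at1] : a \in outs F' D by rewrite inE aD aF'.
apply/orP; right; apply/mapP; exists (t.1, t0.2 ++ t.2) => //.
by apply/mapP; exists t.
Qed.

(** The vertices of [t0] survive only as prefixes of the prolonged trails, whence the condition that
    [ts'] is nonempty. *)
Lemma join_cover C D ts t0 ts' : t0 \in ts -> ts' != [::] ->
  C \subset flatten [seq t.2 | t <- ts] ->
  D \subset flatten [seq t.2 | t <- ts'] ->
  C :|: D \subset flatten [seq t.2 | t <- join ts t0 ts'].
Proof.
move=> t0ts ts'0 /subsetP cC /subsetP cD.
have sub t x : t \in join ts t0 ts' -> x \in t.2 ->
    x \in flatten [seq t.2 | t <- join ts t0 ts'].
  by move=> tj xt; apply/flattenP; exists t.2 => //; apply: map_f.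
have subr t : t \in ts' -> (t.1, t0.2 ++ t.2) \in join ts t0 ts'.
  by move=> tts; rewrite mem_cat; apply/orP; right; apply/mapP; exists t.
apply/subsetP => x; rewrite inE => /orP[/cC|/cD] /flattenP[p /mapP[t tts ->] xp].
  move: tts; rewrite (perm_mem (perm_to_rem t0ts)) inE => /orP[/eqP tE|trem].
    case: ts' ts'0 subr {cD} sub => // t1 ts' _ subr sub.
    by apply: sub (subr t1 _) _; rewrite ?inE ?eqxx //= mem_cat -tE xp.
  by apply: sub xp; rewrite mem_cat trem.
by apply: sub (subr t tts) _; rewrite /= mem_cat xp orbT.
Qed.

(** A block with a free in-arc is open. Breaker takes its other in-arcs, of which there are at most
    [d - 2], and the block becomes closed. *)
Lemma good_block_self F C b : b \in F -> tgt b \in C -> 1 < d ->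
  good_block F C ->
  exists2 K : {set A}, K \subset F :\ b & #|K| <= d - 2 /\
    good_block (F :\ b :\: K) C.
Proof.
move=> uvF vC d1 [[r [w [ts [insr insw tr sz /andP[_ cov]]]]]|[ins0 _]]; last first.
  by have := in_set0 b; rewrite -ins0 inE uvF /= vC.
have uvi : b \in ins F C by rewrite inE uvF.
exists (ins F C :\ b).
  by rewrite setSD //; apply/subsetP => a; rewrite inE => /andP[].
split; first by move: insw; rewrite [#|ins F _|](cardsD1 b) uvi; clear; lia.
right; apply: (@closed_blockI _ _ ts w.+1) => //; last by lia.
  by apply/setP => a; rewrite !inE; case: eqP; case: (a \in F); case: (tgt a \in C).
by apply: tracks_mono tr; rewrite setDDl subsetDl.
Qed.

(** The free in-arc [b] shows that [D] is open with root [tgt b]. Its other in-arcs cost Breaker at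
    most [d - 2 - w] edges, and the two cases for [C] decide where the [w] spare ones go. *)
Lemma good_block_disjoint F C D b : b \in F -> e (src b) (tgt b) ->
  src b \in C -> tgt b \in D -> 1 < d -> [disjoint C & D] ->
  good_block F C -> good_block F D ->
  exists2 K : {set A}, K \subset F :\ b & #|K| <= d - 2 /\
    good_block (F :\ b :\: K) (C :|: D).
Proof.
set u := src b; set v := tgt b => uvF euv uC vD d1 dis gC.
case=> [[r [w [ts [insr insw tr sz /andP[hd cov]]]]]|[ins0 _]];
  last by have := in_set0 b; rewrite -ins0 inE uvF /= vD.
have uvi : b \in ins F D by rewrite inE uvF.
have rv : r = v by rewrite -(insr _ uvi).
rewrite {}rv {r} in hd insr.
have vC : v \notin C.
  by apply/negP => vC; move/pred0P: dis => /(_ v) /=; rewrite vC vD.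
have insF B : ins F B \subset F by apply/subsetP => a; rewrite inE => /andP[].
have outsF B : outs F B \subset F by apply/subsetP => a; rewrite inE => /andP[].
have insDw : #|ins F D :\ b| + w <= d - 2.
  by move: insw; rewrite [#|ins F _|](cardsD1 b) uvi; clear; lia.
have uvo : b \in outs F C by rewrite inE uvF.
have out_track ts' : tracks F C ts' -> exists2 t, t \in ts' & t.1 = b.
  by case/andP => _ /subsetP/(_ _ uvo)/mapP[t tts ->]; exists t.
have ts0 : ts != [::].
  by apply: contraL vD => /eqP ts0; apply/negP => /(subsetP cov); rewrite ts0.
case: gC => [[r [w' [ts' [insr' insw' tr' sz' /andP[hd' cov']]]]]|[ins0 [ts' tr' wt]]].
  have [J sJ cJ] : exists2 J : {set A}, J \subset ins F C & #|J| = minn w #|ins F C|.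
    exists [set a in take w (enum (ins F C))].
      by apply/subsetP => a; rewrite inE => /mem_take; rewrite mem_enum.
    by rewrite cardsE (card_uniqP _) ?take_uniq ?enum_uniq // size_take_min -cardE.
  have uvJ : b \notin J by apply: contra vC => /(subsetP sJ); rewrite inE => /andP[].
  exists ((ins F D :\ b) :|: J).
    by rewrite subUset setSD //= subsetD1 uvJ (subset_trans sJ).
  split.
    apply: leq_trans (leq_card_setU _ _) (leq_trans _ insDw).
    by rewrite leq_add2l cJ geq_minl.
  set F' := _ :\: _.
  have insE : ins F' (C :|: D) = ins F C :\: J.
    apply/setP => a; rewrite !inE; case: (boolP (a \in J)) => //= aJ.
      by rewrite orbT.
    rewrite orbF; case: eqP => [-> /=|_ /=]; first by rewrite (negbTE vC) andbF.
    case aF: (a \in F) => //=; case aC: (tgt a \in C).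
      by rewrite (disjointFr dis aC).
    by case: (tgt a \in D).
  have sF : F' \subset F :\ b by apply: subsetDl.
  have sFF : F' \subset F by apply: subset_trans sF (subsetDl _ _).
  have [t0 t0ts t0E] := out_track _ tr'.
  have trJ : tracks F' (C :|: D) (join ts' t0 ts).
    by apply: (@tracks_join F _ C D v); rewrite ?t0E //; apply: tracks_mono tr.
  have covJ := join_cover t0ts ts0 cov' cov.
  have szJ : size (join ts' t0 ts) <= (w' + w).+1.
    rewrite size_join //; case: (ts') t0ts sz' => // ? ? _; move: sz; clear.
    by rewrite /=; lia.
  (* Either the spare edges exhaust the in-arcs of [C] and the union closes with at most [2 * d]
     trails, or [w] in-arcs of [C] disappear and the union is open with root [r] and the spare
     counts added: the in-arc loss makes up for the gain of [w]. *)
  have [le|lt] := leqP #|ins F C| w.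
    right; apply: (closed_blockI _ trJ covJ szJ); last by move: insw insw'; clear; lia.
    apply/eqP; rewrite insE setD_eq0.
    rewrite (_ : J = ins F C) ?subxx //; by apply/eqP; rewrite eqEcard sJ cJ (minn_idPr le) leqnn.
  left; exists r, (w' + w), (join ts' t0 ts); split=> //.
  - by move=> a; rewrite insE => /setDP[/insr'].
  - by rewrite insE cardsD (setIidPr sJ) cJ; move: insw insw' lt; clear; lia.
  rewrite covJ andbT; apply/allP => t /mem_join[/(allP hd')//|[t' _ -> /=]].
  case/andP: tr' => /allP/(_ _ t0ts)/and5P[t00 _ _ _ _] _.
  by move: (allP hd' _ t0ts); case: (t0.2) t00.
have [t0 t0ts t0E] := out_track _ tr'.
have trL : {in ts, forall t, size t.2 <= L}.
  by move=> t; case/andP: tr => /allP tr _ /tr/trail_size_le.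
(* Only the out-arc of [ts''] survives, and [#|D|] is paid for by the drop of the weights. *)
have finish K' ts'' : K' \subset outs F D -> #|K'| <= w -> {subset ts'' <= ts} ->
    outs (F :\: K') D \subset [seq t.1 | t <- ts''] ->
    #|D| + \sum_(t <- ts'') weight (t.1, t0.2 ++ t.2) <= weight t0 ->
  exists2 K : {set A}, K \subset F :\ b & #|K| <= d - 2 /\
    good_block (F :\ b :\: K) (C :|: D).
  move=> sK cK sts oK wK; exists ((ins F D :\ b) :|: K').
    rewrite subUset setSD //= subsetD1 (subset_trans sK) //=.
    apply: contraL uC => /(subsetP sK); rewrite inE => /andP[_ /= uD].
    by apply/negP => uC; move/pred0P: dis => /(_ u) /=; rewrite uC uD.
  split.
    apply: leq_trans (leq_card_setU _ _) (leq_trans _ insDw).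
    by rewrite leq_add2l.
  set F' := _ :\: _.
  have sF : F' \subset F :\ b by apply: subsetDl.
  have sFK : F' \subset F :\: K'.
    apply/subsetP => a; rewrite !inE => /andP[/norP[_ ->]] /andP[_ ->] //.
  have sFF : F' \subset F by apply: subset_trans sF (subsetDl _ _).
  right; split.
    apply/setP => a; have := in_set0 a; rewrite -ins0 !inE.
    by case: eqP; case: (a \in F); case: (tgt a \in C); case: (tgt a \in D);
      rewrite ?andbF ?orbT.
  exists (join ts' t0 ts'').
    apply: (@tracks_join F _ C D v) => //; rewrite ?t0E //=.
      by apply: (tracksS sFF tr sts); apply: subset_trans oK; apply: outsS.
    by apply/allP => t /sts /(allP hd).
  apply: leq_trans wt; rewrite cardsU disjoint_setI0 // cards0 subn0 -addnA leq_add2l.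
  rewrite /join big_cat big_map /= (perm_big _ (perm_to_rem t0ts)) big_cons /=.
  by rewrite addnCA [weight t0 + _]addnC leq_add2l.
have szt0 : size t0.2 <= L by case/andP: tr' => /allP/(_ _ t0ts)/trail_size_le.
have cardD m := @card_cover_le D ts m cov.
(* With fewer out-arcs than trails there are at most [w] out-arcs, so Breaker takes them all; no
   trail of [D] survives, and the weight of the discarded [t0] pays for [D]. *)
have [lt|le] := ltnP #|outs F D| (size ts).
  apply: (finish (outs F D) [::]) => //; first by move: lt sz; clear; lia.
    by apply/subsetP => a; rewrite !inE; case: (a \in F); case: (src a \in D).
  rewrite big_nil addn0; apply: leq_trans (cardD _ trL) _.
  rewrite /weight leq_mul //; first by move: insw sz; clear; lia.
  by rewrite mul2n -addnn -addnBA // leq_addr.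
have [t1 t1ts t1max] : exists2 t, t \in ts & {in ts, forall t', size t'.2 <= size t.2}.
  have [t tts] : exists t, t \in ts by case: (ts) ts0 => // t s _; exists t; rewrite inE eqxx.
  have [i iP imax] := @arg_maxnP 'I_(size ts) (Ordinal (etrans (index_mem t ts) tts)) xpredT
    (fun i => size (nth t ts i).2) isT.
  exists (nth t ts i) => [|t' t'ts]; first exact: mem_nth.
  have := imax (Ordinal (etrans (index_mem t' ts) t'ts)) isT.
  by rewrite /= nth_index.
(* There are now at least as many free out-arcs as trails, so every label is a free out-arc, that of
   the longest trail included. *)
have t1o : t1.1 \in outs F D.
  have oD : outs F D \subset [seq t.1 | t <- ts] by case/andP: tr.
  have so : {subset enum (outs F D) <= [seq t.1 | t <- ts]}.
    by move=> a; rewrite mem_enum; apply: (subsetP oD).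
  have szo : size [seq t.1 | t <- ts] <= size (enum (outs F D)).
    by rewrite size_map -cardE.
  have [_ eqo] := uniq_min_size (enum_uniq _) so szo.
  by rewrite -mem_enum eqo map_f.
have oD : #|outs F D| <= size ts.
  case/andP: tr => _ oD; rewrite -(size_map fst).
  by apply: leq_trans (subset_leq_card oD) (card_size _).
apply: (finish (outs F D :\ t1.1) [:: t1]).
- exact: subsetDl.
- by rewrite (cardsD1 t1.1) t1o in oD; move: oD sz; clear; lia.
- by move=> t; rewrite inE => /eqP->.
- apply/subsetP => a; rewrite !inE.
  by case: eqP => //=; case: (a \in F); case: (src a \in D).
(* At most [d] trails no longer than [t1] cover [D], so [#|D|] is at most [d * size t1.2], exactly
   the drop in weight from [t0] to its prolongation by [t1]. *)
rewrite big_seq1 /weight /= size_cat.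
have cD : #|D| <= d * size t1.2.
  by rewrite (leq_trans (cardD _ t1max)) // leq_mul //; move: insw sz; clear; lia.
apply: leq_trans (leq_add cD (leqnn _)) _.
rewrite -mulnDr leq_mul2l subnDA addnC subnK ?leqnn ?orbT //.
by rewrite (leq_trans (trL _ t1ts)) // mul2n -addnn -addnBA // leq_addr.
Qed.

(** Each out-arc gets the one-vertex trail at [v], so the spare count is the out-degree minus one
    and the degree bound gives the rest. *)
Lemma good_block_set1 F v : 0 < #|outs F [set v]| ->
  #|ins F [set v]| + #|outs F [set v]| <= d -> good_block F [set v].
Proof.
move=> o0 le; left; exists v, #|outs F [set v]|.-1.
exists [seq (a, [:: v]) | a <- enum (outs F [set v])]; split.
- by move=> a; rewrite !inE => /andP[_ /eqP].
- by move: o0 le; clear; lia.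
- apply/andP; split.
    apply/allP => t /mapP[a]; rewrite mem_enum !inE => /andP[_ /eqP av] ->.
    by rewrite /trail /= inE eqxx av eqxx implybT.
  by apply/subsetP => a ao; rewrite -map_comp map_id_in // mem_enum.
- by rewrite size_map -cardE; move: o0; clear; lia.
- apply/andP; split; first by apply/allP => t /mapP[a _ ->] /=.
  apply/subsetP => x; rewrite inE => /eqP->; apply/flattenP; exists [:: v].
    have /card_gt0P[a ao] := o0; rewrite -map_comp.
    by apply/mapP; exists a; rewrite ?mem_enum.
  by rewrite inE.
Qed.

End Blocks.

(** * Cycles of logarithmic length from non-backtracking walks *)

Section ShortCycles.
Variables (T : finType) (g : rel T).
Hypotheses (g_sym : symmetric g) (g_irr : irreflexive g).

Fixpoint nonbacktracking (s : seq T) :=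
  if s is a :: s' then
    (if s' is _ :: c :: _ then a != c else true) && nonbacktracking s'
  else true.

Lemma nonbacktracking_cat s1 a b s2 : nonbacktracking (s1 ++ [:: a, b & s2]) =
  nonbacktracking (s1 ++ [:: a; b]) && nonbacktracking [:: a, b & s2].
Proof.
elim: s1 => [|c s1 IH] //.
by case: s1 IH => [|c' [|c'' s1]] /= IH; rewrite ?IH ?andbT ?andbA.
Qed.

Lemma nonbacktracking_rcons s a : nonbacktracking (rcons s a) -> nonbacktracking s.
Proof.
elim: s => //= b s IH /andP[ba /IH->]; rewrite andbT.
by case: s ba {IH} => [|c [|c' s]].
Qed.

Lemma nonbacktracking_rev s : nonbacktracking (rev s) = nonbacktracking s.
Proof.
elim: s => // a [|b [|c s]] IH //.
have rE x y z : rev [:: x, y & z] = rev z ++ [:: y; x].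
  by rewrite !rev_cons -!cats1 -catA.
rewrite rE rev_cons -cats1 -catA nonbacktracking_cat -rE IH.
by rewrite andbC /= andbT eq_sym.
Qed.

(** Strip common last vertices until the two walks enter their end from different vertices. Going
    along one and back along the other then does not backtrack at the turning point, and it returns
    to [x]. *)
Lemma nonbacktracking_meet x p q : path g x p -> nonbacktracking (x :: p) ->
  path g x q -> nonbacktracking (x :: q) -> size p = size q ->
  last x p = last x q -> p != q ->
  exists2 w, [&& path g x w, nonbacktracking (x :: w) & ~~ uniq (x :: w)] &
    size w <= 2 * size p.
Proof.
elim/last_ind: p q => [|p a IH] q; first by case: q.
case/lastP: q => [|q b]; first by rewrite size_rcons.
rewrite !size_rcons !last_rcons => + + + + [szpq] ab; rewrite -{b}ab.
move=> gp np gq nq pq.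
have [lpq|lpq] := eqVneq (last x p) (last x q).
  move: gp gq; rewrite !rcons_path => /andP[gp _] /andP[gq _].
  move: np nq; rewrite -!rcons_cons => /nonbacktracking_rcons np.
  move=> /nonbacktracking_rcons nq; have [|w wP sw] := IH q gp np gq nq szpq lpq.
    by apply: contra pq => /eqP->.
  by exists w => //; move: sw; clear; lia.
exists (rcons p a ++ rev (x :: q)); last first.
  by rewrite size_cat size_rcons size_rev /= szpq; clear; lia.
apply/and3P; split.
- rewrite cat_path gp last_rcons -[x :: q](belast_rcons x q a) /=.
  rewrite -[a in path g a](last_rcons x q a) rev_path.
  by rewrite (eq_path (e' := g)) // => y z; rewrite g_sym.
- rewrite -cat_cons -rcons_cons lastI -!cats1 -catA /= -catA /=.
  rewrite [x :: q]lastI rev_rcons nonbacktracking_cat /= lpq.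
  apply/andP; split.
    by move: np; rewrite -rcons_cons lastI -!cats1 -catA.
  have : nonbacktracking (rev (rcons (x :: q) a)) by rewrite nonbacktracking_rev.
  by rewrite rev_rcons [x :: q]lastI rev_rcons.
- by rewrite /= mem_cat mem_rev inE eqxx orbT.
Qed.

(** Pass to a suffix that repeats only its first vertex; the stretch up to the repetition is a
    cycle. Irreflexivity excludes length 1, and non-backtracking excludes length 2. *)
Lemma nonbacktracking_cycle x w : path g x w -> nonbacktracking (x :: w) ->
  ~~ uniq (x :: w) -> exists c,
  [/\ cycle g c, uniq c, 2 < size c, size c <= size w & {subset c <= x :: w}].
Proof.
elim: w x => // y w IH x /andP[gxy gw] /andP[nbx nbw] nu.
have [uw|nuw] := boolP (uniq (y :: w)); last first.
  have [c [cc uc c2 cw sc]] := IH y gw nbw nuw; exists c; split=> //.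
    exact: leq_trans cw _.
  by move=> z /sc; rewrite !inE => ->; rewrite orbT.
move: nu; rewrite cons_uniq uw andbT negbK inE => /orP[/eqP xy|xw].
  by rewrite xy g_irr in gxy.
case/splitPr: xw gxy gw nbx uw => w1 w2 gxy gw nbx uw.
have /andP[gw1 /= /andP[gw1x _]] : path g y w1 && path g (last y w1) (x :: w2).
  by rewrite -cat_path.
exists (x :: y :: w1); split.
- by rewrite /= gxy rcons_path gw1.
- move: uw; rewrite -cat_cons uniq_catC cat_cons cons_uniq mem_cat negb_or.
  case/andP=> /andP[_ xw]; rewrite cat_uniq => /and3P[_ _].
  by rewrite [uniq [:: x, y & w1]]cons_uniq xw.
- by case: w1 nbx {gw gw1 gw1x uw} => //=; rewrite eqxx.
- by rewrite /= size_cat /= addnS ltnS ltnS leq_addr.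
- by move=> z; rewrite !inE !mem_cat => /or3P[] ->; rewrite ?orbT.
Qed.

Hypothesis deg3 : forall x, 2 < #|[set y | g x y]|.

(** The boolean is read as an index 0 or 1 among the neighbours of [b] other than [a]. Minimum
    degree 3 provides two of them, so the default is never reached. *)
Definition turn (a b : T) (i : bool) := nth a (enum ([set y | g b y] :\ a)) i.

Lemma turn_mem a b i : turn a b i \in [set y | g b y] :\ a.
Proof.
rewrite -mem_enum mem_nth // -cardE; have := deg3 b.
by rewrite (cardsD1 a); case: (a \in _); case: i => /=; clear; lia.
Qed.

Lemma turn_inj a b : injective (turn a b).
Proof.
move=> i j /eqP; rewrite nth_uniq ?enum_uniq // -?cardE.
- by case: i j => [] [].
- by have := deg3 b; rewrite (cardsD1 a); case: (a \in _); case: i; clear; lia.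
- by have := deg3 b; rewrite (cardsD1 a); case: (a \in _); case: j; clear; lia.
Qed.

Fixpoint turns (a b : T) (s : seq bool) :=
  if s is i :: s' then turn a b i :: turns b (turn a b i) s' else [::].

Lemma size_turns a b s : size (turns a b s) = size s.
Proof. by elim: s a b => //= i s IH a b; rewrite IH. Qed.

Lemma turns_inj a b : injective (turns a b).
Proof.
move=> s; elim: s a b => [|i s IH] a b [|j s'] //= [/turn_inj<- /IH<-] //.
Qed.

Lemma turns_walk a b s : path g b (turns a b s) && nonbacktracking (b :: turns a b s).
Proof.
elim: s a b => //= i s IH a b.
have := turn_mem a b i; rewrite !inE => /andP[_ ->] /=.
have /andP[-> ->] := IH b (turn a b i); rewrite andbT /=.
case: s {IH} => //= j s.
by have := turn_mem b (turn a b i) j; rewrite !inE eq_sym => /andP[].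
Qed.

Lemma short_cycle k x : #|T| < 2 ^ k -> exists c w,
  [/\ cycle g c, uniq c, 2 < size c, size c <= 2 * k &
   [/\ path g x w, size w <= 2 * k & {subset c <= x :: w}]].
Proof.
(* Bit strings encode [2 ^ k] distinct walks from [x], so two of them share their end. The first
   step has no previous vertex, and [x] itself, not its own neighbour, stands in for it. *)
move=> Tk; pose f (s : k.-tuple bool) := last x (turns x x s).
have /injectivePn[s [s' ss' fss']] : ~~ injectiveb f.
  apply: contraL Tk => /injectiveP /leq_card; rewrite -leqNgt.
  by rewrite card_tuple card_bool.
have /andP[gs ns] := turns_walk x x s; have /andP[gs' ns'] := turns_walk x x s'.
have [||w /and3P[gw nw uw]] := nonbacktracking_meet gs ns gs' ns' _ fss'.
- by rewrite !size_turns !size_tuple.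
- by apply: contra ss' => /eqP/turns_inj/val_inj->.
rewrite size_turns size_tuple => sw.
have [c [cc uc c2 cw sc]] := nonbacktracking_cycle gw nw uw.
by exists c, w; split=> //; apply: leq_trans cw sw.
Qed.

End ShortCycles.

(** * An orientation with out-arcs everywhere and only short simple directed paths *)

Section Orientation.
Variables (T : finType) (g : rel T) (d k : nat).
Hypotheses (g_sym : symmetric g) (g_irr : irreflexive g).
Hypothesis deg_le : forall x, #|[set y | g x y]| <= d.
Hypothesis deg3 : forall x, 2 < #|[set y | g x y]|.
Hypothesis card_lt : #|T| < 2 ^ k.
Implicit Types (Z : {set T}).

Lemma proper_colouring : exists c : T -> 'I_d.+1, forall x y, g x y -> c x != c y.
Proof.
suff H (s : seq T) : exists c : T -> 'I_d.+1,
    {in s &, forall x y, g x y -> c x != c y}.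
  have [c cP] := H (enum T); exists c => x y; apply: cP; exact: mem_enum.
elim: s => [|x s [c cP]]; first by exists (fun=> ord0).
have [a aP] : exists a, a \notin c @: [set y | g x y].
  apply/existsP; rewrite -negb_forall; apply/negP => /forallP cT.
  have := leq_trans (leq_imset_card c [set y | g x y]) (deg_le x).
  rewrite leqNgt => /negP; apply.
  by rewrite -{1}(card_ord d.+1) -cardsT subset_leq_card //; apply/subsetP.
have ca y : g x y -> c y != a.
  by move=> gxy; apply: contra aP => /eqP<-; apply: imset_f; rewrite inE.
exists (fun z => if z == x then a else c z) => y z; rewrite !inE.
case: eqP => [->|_] /= ys; case: eqP => [->|_] /= zs.
- by rewrite g_irr.
- by rewrite eq_sym; apply: ca.
- by rewrite g_sym; apply: ca.
- exact: cP.
Qed.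

(* The vertex set of a family of pairwise non-adjacent cycles, with the successor
   map [f] and with the cycle lengths controlled by simple paths. *)
Definition cycle_factor Z := exists2 f : T -> T,
  {in Z, forall x, [/\ f x \in Z, g x (f x) & f (f x) != x]} &
  forall p, sorted g p -> uniq p -> all [in Z] p -> size p <= 2 * k.

(** Without edges between [c] and [Z], a path in the union stays in one of them; inside [c] a simple
    path has at most [size c] vertices. *)
Lemma cycle_factor_extend Z c : cycle_factor Z ->
  cycle g c -> uniq c -> 2 < size c -> size c <= 2 * k ->
  (forall x y, x \in c -> y \in Z -> ~~ g x y) -> {in c, forall x, x \notin Z} ->
  cycle_factor (Z :|: [set x in c]).
Proof.
move=> [f fP pZ] gc uc c2 ck cZ cnZ.
exists (fun x => if x \in c then next c x else f x) => [x|].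
  rewrite !inE; case: ifPn => [xc _|xc]; last first.
    rewrite orbF => /fP[fZ gf ff]; rewrite fZ; split=> //.
    by rewrite (contraTF (cnZ (f x)) fZ).
  rewrite mem_next xc orbT; split=> //; first exact: next_cycle.
  (* Rotate [c] to start at [x]: its third vertex is [next c (next c x)], and it differs from
     [x]. *)
  have [i c' cE] := rot_to xc; rewrite -!(next_rot i uc) cE.
  have := uc; rewrite -(rot_uniq i) cE; have := c2; rewrite -(size_rot i) cE.
  case: c' {cE} => [|y [|z c']] //= _; rewrite eqxx !inE !negb_or.
  case/andP=> /and3P[xy xz _] _.
  by rewrite [y == x]eq_sym (negbTE xy) eqxx [z == x]eq_sym.
have stay (p : seq T) x : path g x p -> all [in Z :|: [set x in c]] (x :: p) ->
    all (fun y => (y \in c) == (x \in c)) p.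
  elim: p x => //= y p IH x /andP[gxy gp] /and3P[xZc yZc pZc].
  have yx : (y \in c) = (x \in c).
    move: xZc yZc; rewrite !inE; case xc: (x \in c); case yc: (y \in c); rewrite ?orbT ?orbF //.
      by move=> _ yZ; have := cZ x y xc yZ; rewrite gxy.
    by move=> xZ _; have := cZ y x yc xZ; rewrite g_sym gxy.
  by rewrite yx eqxx /=; move: (IH y gp); rewrite /= yx yZc; apply.
move=> [|x p] // gp up pZc; have sp := stay _ _ gp pZc.
have [xc|xc] := boolP (x \in c).
  apply: leq_trans ck; apply: uniq_leq_size => // y.
  by rewrite inE => /orP[/eqP-> //|/(allP sp)]; rewrite xc => /eqP.
apply: pZ => //; apply/allP => y yp; have := allP pZc y yp; rewrite !inE => /orP[//|].
move: yp; rewrite inE => /orP[/eqP->|/(allP sp)/eqP->]; by rewrite (negbTE xc).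
Qed.

(** The product counts the pairs of a distance at most [2 * k + 1] and one of [d + 1] colours, which
    bound the part of a path outside the cycles; the last [2 * k] is for the part inside. *)
Definition path_bound := (2 * k + 2) * d.+1 + 2 * k.

(** Take [Z] maximal. A short cycle within [2 * k] steps of [x] must meet [Z] or be adjacent to it,
    since otherwise it could be added; adjacency costs the one extra step. *)
Lemma near_cycle_factor : exists2 Z, cycle_factor Z &
  forall x, exists p, [/\ path g x p, size p <= (2 * k).+1 & last x p \in Z].
Proof.
have ex0 : exists Z, `[< cycle_factor Z >].
  exists set0; apply/asboolP; exists id => [x|[|x p]] //; first by rewrite inE.
  by move=> _ _ /=; rewrite inE.
have [Z /maxsetP[/asboolP ZP Zmax]] := ex_maxset ex0.
exists Z => // x.
have [c [w [gc uc c2 ck [gw wk sc]]]] := short_cycle g_sym g_irr deg3 x card_lt.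
have walk y : y \in c -> exists q, [/\ path g x q, size q <= 2 * k & last x q = y].
  move/sc; rewrite inE => /orP[/eqP->|]; first by exists [::].
  move=> yw; case/splitPr: yw gw wk => w1 w2 gw wk; exists (rcons w1 y).
  rewrite last_rcons; split=> //.
    by move: gw; rewrite -cat_rcons cat_path => /andP[].
  by move: wk; rewrite size_rcons size_cat /=; clear; lia.
have [/hasP[y yc yZ]|/hasPn cZ] := boolP (has [in Z] c).
  have [q [gq qk qy]] := walk y yc; exists q; rewrite qy; split=> //.
  exact: leqW.
have [/existsP[y /existsP[z /and3P[yc zZ gyz]]]|adjZ] :=
    boolP [exists y, exists z, [&& y \in c, z \in Z & g y z]].
  have [q [gq qk qy]] := walk y yc; exists (rcons q z).
  by rewrite rcons_path size_rcons last_rcons qy gq gyz; split.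
have [x0 xc] : exists x0, x0 \in c.
  by case: (c) c2 => // x0 c' _; exists x0; rewrite inE eqxx.
have := Zmax (Z :|: [set x in c]).
rewrite subsetUl => /(_ _ isT) ZE.
have : x0 \in Z.
  rewrite -ZE; first by rewrite !inE xc orbT.
  apply/asboolP/cycle_factor_extend => // y z yc zZ; apply: contra adjZ => gyz.
  by apply/existsP; exists y; apply/existsP; exists z; rewrite yc zZ.
by move=> xZ; have := cZ x0 xc; rewrite /= xZ.
Qed.

Lemma bounded_orientation : exists e : rel T,
  [/\ forall x y, e x y -> g x y, forall x y, g x y -> e x y (+) e y x,
      forall x, exists y, e x y &
      forall p, sorted e p -> uniq p -> size p <= path_bound].
Proof.
have [Z [f fP pZ] nearZ] := near_cycle_factor.
have [c cP] := proper_colouring.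
(* [lev x] is the distance from [x] to [Z]. *)
have /choice[lev levP] : forall x, exists l,
    (exists p, [/\ path g x p, size p = l & last x p \in Z]) /\
    (forall p, path g x p -> last x p \in Z -> l <= size p).
  move=> x; have exP : exists l, `[< exists p, [/\ path g x p, size p = l & last x p \in Z] >].
    have [p [gp _ pz]] := nearZ x; exists (size p); apply/asboolP; by exists p.
  case: (ex_minnP exP) => l /asboolP lP lmin; exists l; split=> // p gp pz.
  by apply: lmin; apply/asboolP; exists p.
have levZ x : (lev x == 0) = (x \in Z).
  have [[p [gp <- pz]] pmin] := levP x; apply/idP/idP => [|xZ].
    by rewrite size_eq0 => /eqP pE; move: pz; rewrite pE.
  by rewrite -leqn0; apply: (pmin [::]).
have lev_le x : lev x <= (2 * k).+1.
  by have [p [gp pk pz]] := nearZ x; have [_ pmin] := levP x; apply: leq_trans (pmin p gp pz) pk.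
have lev_down x : x \notin Z -> exists2 y, g x y & lev y < lev x.
  have [[[|y p] [gp <- pz]] _] := levP x; first by move: pz => /= ->.
  move=> _; exists y; first by case/andP: gp.
  by have [_ ymin] := levP y; rewrite ltnS; apply: ymin => //; case/andP: gp.
(* [rho] orders vertices lexicographically by distance, then colour. *)
pose rho x := lev x * d.+1 + c x.
have rho_lev x y : lev x < lev y -> rho x < rho y.
  by rewrite /rho; have := ltn_ord (c x); clear; nia.
have rho_lt x : rho x < (2 * k + 2) * d.+1.
  by rewrite /rho; have := ltn_ord (c x); have := lev_le x; clear; nia.
(* Inside [Z], arcs follow [f]. The remaining edges inside [Z] may point either way, because the
   length bound there holds for all simple paths of [g]; [enum_rank] breaks the tie. *)
pose e x y := g x y &&
  (if (x \in Z) && (y \in Z)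
   then (f x == y) || (f y != x) && (enum_rank x < enum_rank y) else rho y < rho x).
exists e; split.
- by move=> x y /andP[].
- move=> x y gxy; have gyx : g y x by rewrite g_sym.
  rewrite /e gxy gyx /= [(y \in Z) && _]andbC.
  case: ifP => [/andP[xZ yZ]|xyZ].
    have [fx|fx] := eqVneq (f x) y.
      (* [f (f x) != x] prevents an edge from being oriented both ways. *)
      have [_ _] := fP x xZ; rewrite fx => /negbTE->; by [].
    have [fy|fy] //= := eqVneq (f y) x.
    have : enum_rank x != enum_rank y.
      by rewrite (inj_eq enum_rank_inj); apply: contraTneq gxy => ->; rewrite g_irr.
    by rewrite -val_eqE /=; case: ltngtP.
  have : rho x != rho y.
    have [lxy|lxy|lxy] := ltngtP (lev x) (lev y).
    - by rewrite neq_ltn (rho_lev _ _ lxy).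
    - by rewrite neq_ltn (rho_lev _ _ lxy) orbT.
    - by rewrite /rho lxy eqn_add2l; apply: cP.
  by case: ltngtP.
- move=> x; have [xZ|xZ] := boolP (x \in Z).
    by have [fZ gf _] := fP x xZ; exists (f x); rewrite /e xZ fZ gf eqxx.
  have [y gxy lyx] := lev_down x xZ; exists y.
  by rewrite /e gxy (negbTE xZ) /= rho_lev.
have stay x y : x \in Z -> e x y -> y \in Z.
  rewrite /e => xZ /andP[_]; rewrite xZ /=; case: ifP => // yZ.
  rewrite ltnNge => /negP[]; apply/ltnW/rho_lev.
  by rewrite (eqP (_ : lev x == 0)) ?levZ // lt0n levZ yZ.
have stayp x p : x \in Z -> path e x p -> all [in Z] (x :: p).
  elim: p x => [|y p IH] x xZ /=; first by rewrite xZ.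
  by case/andP=> /(stay _ _ xZ) yZ /(IH y yZ) /= ->; rewrite xZ.
have sub_g p : sorted e p -> sorted g p by apply: sub_sorted => x y /andP[].
have inZ x p : x \in Z -> path e x p -> uniq (x :: p) -> size (x :: p) <= 2 * k.
  by move=> xZ ep up; apply: pZ => //; [apply: sub_g | apply: stayp].
(* Each arc from outside [Z] lowers [rho], and a path that has entered [Z] cannot leave it. *)
have bnd x p : path e x p -> uniq (x :: p) -> size (x :: p) <= (rho x).+1 + 2 * k.
  elim: p x => [|y p IH] x; first by clear; rewrite /=; lia.
  have [xZ ep up|xZ] := boolP (x \in Z).
    by apply: leq_trans (inZ _ _ xZ ep up) _; apply: leq_addl.
  rewrite cons_uniq => /andP[exy ep] /andP[_ up].
  have : rho y < rho x by move: exy; rewrite /e (negbTE xZ) => /andP[].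
  by have := IH y ep up; rewrite /=; clear; lia.
move=> [|x p] // ep up; apply: leq_trans (bnd x p ep up) _.
by rewrite /path_bound leq_add2r.
Qed.

End Orientation.

(** * From an invariant to a complete play *)

Section Breaker.
Variables (T : finType) (b : nat) (G : sgraph T).
Implicit Types (M F : {set {set T}}) (h : history T).

Lemma maker_edges_rcons h a D : maker_edges (rcons h (a, D)) = a |: maker_edges h.
Proof. by apply/setP => x; rewrite !inE map_rcons mem_rcons inE. Qed.

Lemma free_rcons h a D : Defs.free G (rcons h (a, D)) = Defs.free G h :\ a :\: D.
Proof.
rewrite /Defs.free maker_edges_rcons /breaker_edges -cats1 big_cat big_seq1 /=.
apply/setP => x; rewrite !inE.
by case: (x == a); case: (x \in D); case: (x \in breaker_edges h);
  case: (x \in G); rewrite ?andbF ?orbT ?orbF.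
Qed.

Lemma reply_above (F K : {set {set T}}) : K \subset F -> #|K| <= b ->
  exists2 D, breaker_reply b F D & K \subset D.
Proof.
move=> sK Kb; pose s := take (minn b #|F| - #|K|) (enum (F :\: K)).
have ssub x : x \in s -> (x \in F) && (x \notin K).
  by move=> /mem_take; rewrite mem_enum inE andbC.
exists (K :|: [set x in s]); last exact: subsetUl.
apply/andP; split.
  by rewrite subUset sK; apply/subsetP => x; rewrite inE => /ssub/andP[].
rewrite cardsU (_ : K :&: _ = set0) ?cards0 ?subn0.
  rewrite cardsE (card_uniqP _) ?take_uniq ?enum_uniq // size_take_min -cardE cardsD.
  by rewrite (setIidPr sK); have := subset_leq_card sK; move: Kb; clear; lia.
by apply/setP => x; rewrite !inE; apply/negP => /andP[xK /ssub]; rewrite xK andbF.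
Qed.

(** [K] holds the edges Breaker wants. The rules may force him to claim more, which is harmless
    because the invariant survives any loss of free edges. *)
Lemma breaker_maintains (I : {set {set T}} -> {set {set T}} -> Prop) (sigma : strategy T) :
  legal b G sigma -> I set0 (edges G) ->
  (forall M F F', F' \subset F -> I M F -> I M F') ->
  (forall M F a, I M F -> a \in F ->
     exists2 K : {set {set T}}, K \subset F :\ a & #|K| <= b /\ I (a |: M) (F :\ a :\: K)) ->
  exists h, [/\ play b G sigma h, Defs.free G h = set0 & I (maker_edges h) set0].
Proof.
move=> leg I0 ImonoF Istep.
suff H n h : play b G sigma h -> I (maker_edges h) (Defs.free G h) -> #|Defs.free G h| <= n ->
    exists h, [/\ play b G sigma h, Defs.free G h = set0 & I (maker_edges h) set0].
  apply: (H #|Defs.free G [::]| [::]) => //; first exact: play_start.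
  rewrite (_ : maker_edges _ = set0); last by apply/setP => x; rewrite !inE.
  by apply: ImonoF I0; apply: subsetDl.
elim: n h => [|n IH] h ph Ih.
  by rewrite leqn0 cards_eq0 => /eqP F0; exists h; split=> //; rewrite -F0.
have [F0 _|F0 le] := eqVneq (Defs.free G h) set0.
  by exists h; split=> //; rewrite -F0.
have aF := leg h ph F0.
have [K sK [Kb IK]] := Istep _ _ _ Ih aF.
have [D rD sD] := reply_above sK Kb.
apply: (IH _ (play_round ph aF rD)).
  rewrite maker_edges_rcons free_rcons; apply: ImonoF IK.
  exact: setDS.
rewrite free_rcons; apply: leq_trans (subset_leq_card (subsetDl _ _)) _.
by rewrite (cardsD1 (sigma h)) aF in le.
Qed.

End Breaker.

(** * The component bound for regular graphs *)

Section Regular.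
Variables (T : finType) (G : sgraph T) (d : nat).
Hypotheses (d3 : 2 < d) (Gd : regular d G).

Lemma adj_sym (M : {set {set T}}) : symmetric (adj M).
Proof. by move=> x y; rewrite /adj /= setUC. Qed.

Lemma edge_card a : a \in edges G -> #|a| = 2.
Proof. by case: G => E /= /forall_inP EP /EP/eqP. Qed.

Lemma adj_irr : irreflexive (adj (edges G)).
Proof.
move=> x; apply/negP => /= /edge_card; rewrite setUid cards1.
by [].
Qed.

Lemma set2_inj (x : T) : injective (fun y => [set x; y]).
Proof.
move=> y z /setP E; have := E z; rewrite !inE eqxx orbT => /orP[/eqP zx|/eqP->//].
by have := E y; rewrite !inE eqxx orbT zx orbb => /esym/eqP.
Qed.

Lemma card_neighbours x : #|[set y | adj (edges G) x y]| = d.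
Proof.
have /forallP/(_ x)/eqP <- := Gd.
rewrite -(card_imset _ (@set2_inj x)); apply: eq_card => a.
rewrite inE; apply/imsetP/andP => [[y + ->]|[aG xa]].
  by rewrite inE => gxy; rewrite !inE eqxx.
have /cards2P[u [v [uv aE]]] : #|a| == 2 by rewrite edge_card.
move: xa; rewrite aE !inE => /orP[/eqP xu|/eqP xv].
  by exists v; rewrite ?xu // inE /adj /= -aE.
by exists u; rewrite ?xv 1?setUC // inE /adj /= setUC -aE.
Qed.


Definition component_bound (k : nat) := block_bound d (path_bound d k).

Lemma s_star_le_component_bound k : #|T| < 2 ^ k -> s_star (d - 2) G <= component_bound k.
Proof.
move=> Tk; apply/bigmax_leqP => s /asboolP[sigma leg win].
have [g_sym g_irr] := (adj_sym (edges G), adj_irr).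
have deg_le x : #|[set y | adj (edges G) x y]| <= d by rewrite card_neighbours.
have deg3 x : 2 < #|[set y | adj (edges G) x y]| by rewrite card_neighbours.
have [e [eg eX e_out eL]] := bounded_orientation g_sym g_irr deg_le deg3 Tk.
(* Some play reaches its end, and the component promised there yields a vertex [x0], used as the
   default in [arc]. *)
have [h0 ph0 Fh0] := play_end leg.
have /existsP[x0 _] := win h0 ph0 Fh0.
have /choice[arc arcP] : forall a : {set T}, exists p : T * T,
    a \in edges G -> a = [set p.1; p.2] /\ e p.1 p.2.
  move=> a; have [aG|] := boolP (a \in edges G); last by exists (x0, x0).
  have /cards2P[u [v [uv aE]]] : #|a| == 2 by rewrite edge_card.
  have := eX u v; rewrite {1}/adj /= -aE => /(_ aG).
  have [euv _|_ /= evu] := boolP (e u v); first by exists (u, v).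
  by exists (v, u); rewrite setUC.
pose src a := (arc a).1; pose tgt a := (arc a).2.
have eG x y : e x y -> [set x; y] \in G by exact: eg.
have e_asym x y : e x y -> ~~ e y x by move=> exy; have := eX x y (eg _ _ exy); rewrite exy.
have edgeE x y : e x y -> (src [set x; y] = x) /\ (tgt [set x; y] = y).
  move=> exy; have [] := arcP [set x; y] (eg _ _ exy).
  rewrite -/(src _) -/(tgt _) => E est.
  have : x \in [set src [set x; y]; tgt [set x; y]] by rewrite -E !inE eqxx.
  rewrite !inE => /orP[/eqP xs|/eqP xt].
    by split=> //; apply/esym; apply: (@set2_inj x); rewrite {2}xs.
  have ys : y = src [set x; y] by apply: (@set2_inj x); rewrite {1}E -xt setUC.
  by have := e_asym _ _ exy; rewrite {1}ys {2}xt est.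
pose good := good_block src tgt e d (path_bound d k).
(* [B] sends a vertex to its block in a partition into good blocks that no edge of Maker crosses. *)
pose I (M F : {set {set T}}) := F \subset edges G /\ exists B : T -> {set T},
  [/\ forall x, x \in B x, forall x y, y \in B x -> B y = B x,
      forall x y, [set x; y] \in M -> B x = B y & forall x, good F (B x)].
have [|M F F' sF [FG [B [Bx By BM Bg]]]
     |M F a [FG [B [Bx By BM Bg]]] aF|h [ph Fh [_ [B [Bx By BM Bg]]]]] :=
    @breaker_maintains T (d - 2) G I sigma leg.
- split=> //; exists (fun x => [set x]); split.
  + by move=> x; rewrite inE.
  + by move=> x y; rewrite inE => /eqP->.
  + by move=> x y; rewrite inE.
  move=> x; apply: good_block_set1.
    have [y exy] := e_out x; apply/card_gt0P; exists [set x; y].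
    by rewrite !inE (eG _ _ exy) (edgeE _ _ exy).1 eqxx.
  have /forallP/(_ x)/eqP deg := Gd; rewrite -[X in _ <= X]deg.
  (* A loopless arc cannot both enter and leave [x], so in-degree and out-degree add up to at most
     the degree [d]. *)
  rewrite -cardsUI [X in _ + X](_ : _ = 0) ?addn0.
    apply/subset_leq_card/subsetP => a; rewrite !inE -andb_orr => /andP[aG].
    have [aE _] := arcP a aG; rewrite aG /= => xE.
    by rewrite aE !inE -/(src a) -/(tgt a) orbC ![x == _]eq_sym.
  apply/eqP; rewrite cards_eq0 -subset0; apply/subsetP => a; rewrite !inE.
  case/andP=> /andP[aG /eqP tx] /andP[_ /eqP sx]; have [_] := arcP a aG.
  by rewrite -/(src a) -/(tgt a) tx sx => /eg; rewrite adj_irr.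
- split; first exact: subset_trans FG.
  exists B; split=> // x; exact: good_blockS (Bg x).
- have [aE est] := arcP a (subsetP FG a aF).
  rewrite -/(src a) -/(tgt a) in aE est.
  have ends x y : [set x; y] = a -> x \in a /\ y \in a.
    by move=> <-; rewrite !inE !eqxx orbT.
  have sFK (K : {set {set T}}) : F :\ a :\: K \subset F.
    by apply: subset_trans (subsetDl _ _) (subsetDl _ _).
  have d1 : 1 < d by apply: ltnW.
  have [eqB|neqB] := eqVneq (B (src a)) (B (tgt a)).
    have [K sK [Kd gK]] : exists2 K : {set {set T}}, K \subset F :\ a &
        #|K| <= d - 2 /\ good (F :\ a :\: K) (B (src a)).
      by apply: (good_block_self eL aF _ d1 (Bg (src a))); rewrite eqB Bx.
    exists K => //; split=> //; split; first exact: subset_trans FG.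
    exists B; split=> // [x y|x].
      rewrite in_setU1 => /orP[/eqP/ends|]; last exact: BM.
      by rewrite aE !inE => -[/orP[]/eqP-> /orP[]/eqP->].
    exact: good_blockS (Bg x).
  have dis : [disjoint B (src a) & B (tgt a)].
    apply/pred0P => z /=; apply/negP => /andP[/By zs /By zt].
    by rewrite -zs -zt eqxx in neqB.
  have [K sK [Kd gK]] :=
    good_block_disjoint eL aF est (Bx _) (Bx _) d1 dis (Bg _) (Bg _).
  exists K => //; split=> //; split; first exact: subset_trans FG.
  set C := _ :|: _ in gK.
  have CB x y : x \in C -> y \in B x -> y \in C.
    by rewrite !inE => /orP[]/By E; rewrite E => ->; rewrite ?orbT.
  (* The new partition merges the two blocks joined by Maker's edge. *)
  exists (fun x => if x \in C then C else B x); split.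
  + by move=> x; case: ifP.
  + move=> x y; case: ifPn => [_ -> //|xC yx]; rewrite ifN; first exact: By.
    by apply: contra xC => yC; apply: CB yC _; rewrite (By _ _ yx).
  + move=> x y; rewrite in_setU1 => /orP[/eqP/ends|/BM xy].
      have aC z : z \in a -> z \in C by rewrite aE !inE => /orP[]/eqP->; rewrite Bx ?orbT.
      by case=> /aC-> /aC->.
    rewrite xy; have -> // : (x \in C) = (y \in C).
    by apply/idP/idP => /CB; apply; rewrite ?xy // -xy.
  by move=> x; case: ifP => // _; apply: good_blockS (Bg x).
have /existsP[x sx] := win h ph Fh.
apply: leq_trans sx (leq_trans _ (good_block_card eL (Bg x))).
(* A path of Maker's edges never leaves the block of its start. *)
apply/subset_leq_card/subsetP => y /connectP[p].
elim/last_ind: p y => [|p z IH] y; first by move=> _ ->.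
rewrite rcons_path last_rcons => /andP[/IH/(_ erefl) lx /BM lz] ->.
by rewrite -(By x _ lx) lz.
Qed.

End Regular.

(** * The explicit logarithmic bound *)

(** This is [component_bound d k] multiplied out for [k = trunc_log 2 n + 1], for which
    [n < 2 ^ k]. *)
Definition trunc_log_bound (d n : nat) :=
  (2 * d + 4 * d * d) * ((2 * d + 4) * trunc_log 2 n + (4 * d + 6)).

Lemma s_star_le_trunc_log (T : finType) (G : sgraph T) (d : nat) : 2 < d ->
  regular d G -> s_star (d - 2) G <= trunc_log_bound d #|T|.
Proof.
move=> d3 Gd; have := trunc_log_ltn #|T| (ltnSn 1).
move/(s_star_le_component_bound d3 Gd)/leq_trans; apply.
rewrite /component_bound /block_bound /path_bound /trunc_log_bound.
by move: (trunc_log _ _); clear; nia.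
Qed.

Local Open Scope ring_scope.

Lemma trunc_log_le_ln (R : realType) (n : nat) :
  (trunc_log 2 n)%:R <= ln n%:R / ln 2 :> R.
Proof.
have ln2 : 0 < ln 2 :> R by rewrite ln_gt0 // ltr1n.
(* For [n = 0] both sides vanish, with the convention that [ln 0] is 0. *)
rewrite ler_pdivlMr //; case: n => [|n]; first by rewrite trunc_log0 mul0r ln0.
rewrite mulr_natl -lnXn // ler_ln ?posrE ?ltr0n ?exprn_gt0 //.
by rewrite -natrX ler_nat trunc_logP.
Qed.

Theorem theorem1p2 (R : realType) (d : nat) (hd : (3 <= d)%N) :
  exists alpha beta : R,
    (forall (n : nat) (T : finType) (G : sgraph T),
       #|T| = n -> regular d G ->
       (s_star (d - 2) G)%:R <= alpha + beta * ln n%:R) /\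
    (forall n : nat, (s_star_nd (d - 2) n d)%:R <= alpha + beta * ln n%:R).
Proof.
pose a := (2 * d + 4 * d * d)%N.
(* The constant and the linear part of [trunc_log_bound]; the division by [ln 2] converts the base-2
   logarithm. *)
exists (a * (4 * d + 6))%:R, ((a * (2 * d + 4))%:R / ln 2).
have bound n m : (m <= trunc_log_bound d n)%N ->
    m%:R <= (a * (4 * d + 6))%:R + (a * (2 * d + 4))%:R / ln 2 * ln n%:R :> R.
  rewrite /trunc_log_bound -/a mulnDr mulnA addnC -(ler_nat R) => /le_trans; apply.
  rewrite natrD lerD2l natrM -mulrA ler_wpM2l // mulrC.
  exact: trunc_log_le_ln.
split=> [n T G <- Gd|n]; apply: bound; first exact: s_star_le_trunc_log.
apply/bigmax_leqP => G Gd; rewrite -[X in trunc_log_bound _ X](card_ord n).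
exact: s_star_le_trunc_log.
Qed.
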